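(* Let $\mathcal{H}$ be a set of sequents and $\Pi\to B$ a sequent, all in the product-free language (built using only $\backslash$, $/$, $\wedge$, $\mathbf{0}$, $\mathbf{1}$). If $\Pi\to B$ is derivable from $\mathcal{H}$ in $\mathbf{L}^{\Lambda}\wedge\mathbf{0}\mathbf{1}$, then $\Pi\to B$ is derivable from $\mathcal{H}$ in $\mathbf{L}^{\Lambda}_{\backslash,/}\wedge\mathbf{0}\mathbf{1}$. Moreover, if $\mathcal{H}$ and $\Pi\to B$ additionally contain no occurrences of $\mathbf{0}$ and $\mathbf{1}$, then $\Pi\to B$ is derivable from $\mathcal{H}$ in $\mathbf{L}^{\Lambda}_{\backslash,/}\wedge$.
   Context: Formulae are built from a countable set of propositional variables and the constants $\mathbf{0}$ and $\mathbf{1}$ using the binary connectives $\cdot$, $\backslash$, $/$, $\wedge$. A sequent is $\Pi \to B$ with $B$ a formula and $\Pi$ a finite, possibly empty, sequence of formulae (empty sequence written $\Lambda$). The calculus $\mathbf{L}^{\Lambda}\wedge\mathbf{0}\mathbf{1}$ has the axioms $A \to A$, $\Gamma,\mathbf{0},\Delta \to C$ and $\Lambda \to \mathbf{1}$, and rules (capital Greek letters denote possibly empty sequences): (Cut) from $\Pi \to A$ and $\Gamma, A, \Delta \to C$ infer $\Gamma,\Pi,\Delta\to C$; ($\backslash L$) from $\Pi\to A$ and $\Gamma,B,\Delta\to C$ infer $\Gamma,\Pi,A\backslash B,\Delta\to C$; ($\backslash R$) from $A,\Pi\to B$ infer $\Pi\to A\backslash B$; ($/ L$) from $\Pi\to A$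 and $\Gamma,B,\Delta\to C$ infer $\Gamma,B/A,\Pi,\Delta\to C$; ($/R$) from $\Pi,A\to B$ infer $\Pi\to B/A$; ($\cdot L$) from $\Gamma,A,B,\Delta\to C$ infer $\Gamma,A\cdot B,\Delta\to C$; ($\cdot R$) from $\Pi\to A$ and $\Delta\to B$ infer $\Pi,\Delta\to A\cdot B$; ($\wedge L$) from $\Gamma,A,\Delta\to C$ infer both $\Gamma,A\wedge B,\Delta\to C$ and $\Gamma,B\wedge A,\Delta\to C$; ($\wedge R$) from $\Pi\to A$ and $\Pi\to B$ infer $\Pi\to A\wedge B$; ($\mathbf{1} L$) from $\Gamma,\Delta\to C$ infer $\Gamma,\mathbf{1},\Delta\to C$. The calculus $\mathbf{L}^{\Lambda}_{\backslash,/}\wedge\mathbf{0}\mathbf{1}$ is obtained (in the product-free language) by removing the rules $\cdot L$ and $\cdot R$; the calculus $\mathbf{L}^{\Lambda}_{\backslash,/}\wedge$ (in the language of $\backslash,/,\wedge$ only) is obtained by further removing the axioms $\Gamma,\mathbf{0},\Delta\to C$, $\Lambda\to\mathbf{1}$ and the rule $\mathbf{1}L$. A sequent is derivable from a set of sequents $\mathcal H$ in a calculus if it is derivable when the sequents of $\mathcal H$ are added as extra axioms (Cut being allowed). *)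

(* Defs.v *)
From Stdlib Require Import List.
Import ListNotations.

Inductive formula : Set :=
| Var (n : nat)
| Zero
| One
| Prod (A B : formula)
| Under (A B : formula)  (* [A \ B] *)
| Over (B A : formula)   (* [B / A], denominator second *)
| Meet (A B : formula).

Record sequent : Set := Sequent { antecedent : list formula; succedent : formula }.

Notation "G ⊢ C" := (Sequent G C) (at level 70, no associativity).

Fixpoint product_free (A : formula) : Prop :=
  match A with
  | Var _ | Zero | One => True
  | Prod _ _ => False
  | Under A B | Over A B | Meet A B => product_free A /\ product_free B
  end.

Fixpoint constant_free (A : formula) : Prop :=
  match A with
  | Var _ => True
  | Zero | One => False
  | Prod A B | Under A B | Over A B | Meet A B => constant_free A /\ constant_free B
  end.

Definition sequent_in (lang : formula -> Prop) (s : sequent) : Prop :=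
  Forall lang (antecedent s) /\ lang (succedent s).

(* [R ps s]: [s] is inferred from the list of premises [ps] by one rule
   instance; axioms are the instances without premises. *)
Definition rules := list sequent -> sequent -> Prop.

Inductive lambek_meet_rules : rules :=
| ax_id A :
    lambek_meet_rules [] ([A] ⊢ A)
| cut G P D A C :
    lambek_meet_rules [P ⊢ A; G ++ [A] ++ D ⊢ C] (G ++ P ++ D ⊢ C)
| under_L G P D A B C :
    lambek_meet_rules [P ⊢ A; G ++ [B] ++ D ⊢ C] (G ++ P ++ [Under A B] ++ D ⊢ C)
| under_R P A B :
    lambek_meet_rules [[A] ++ P ⊢ B] (P ⊢ Under A B)
| over_L G P D A B C :
    lambek_meet_rules [P ⊢ A; G ++ [B] ++ D ⊢ C] (G ++ [Over B A] ++ P ++ D ⊢ C)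
| over_R P A B :
    lambek_meet_rules [P ++ [A] ⊢ B] (P ⊢ Over B A)
| meet_L1 G D A B C :
    lambek_meet_rules [G ++ [A] ++ D ⊢ C] (G ++ [Meet A B] ++ D ⊢ C)
| meet_L2 G D A B C :
    lambek_meet_rules [G ++ [A] ++ D ⊢ C] (G ++ [Meet B A] ++ D ⊢ C)
| meet_R P A B :
    lambek_meet_rules [P ⊢ A; P ⊢ B] (P ⊢ Meet A B).

Inductive constant_rules : rules :=
| ax_zero G D C :
    constant_rules [] (G ++ [Zero] ++ D ⊢ C)
| ax_one :
    constant_rules [] ([] ⊢ One)
| one_L G D C :
    constant_rules [G ++ D ⊢ C] (G ++ [One] ++ D ⊢ C).

Inductive product_rules : rules :=
| prod_L G D A B C :
    product_rules [G ++ [A; B] ++ D ⊢ C] (G ++ [Prod A B] ++ D ⊢ C)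
| prod_R P D A B :
    product_rules [P ⊢ A; D ⊢ B] (P ++ D ⊢ Prod A B).

(* Every sequent of the derivation, and hence every cut formula, must lie in
   the language [lang] of the calculus. *)
Inductive derivable (lang : formula -> Prop) (R : rules) (H : sequent -> Prop)
  : sequent -> Prop :=
| derivable_hyp s :
    sequent_in lang s -> H s -> derivable lang R H s
| derivable_rule ps s :
    sequent_in lang s -> R ps s ->
    (forall p, In p ps -> derivable lang R H p) ->
    derivable lang R H s.

Definition derivable_L01 : (sequent -> Prop) -> sequent -> Prop :=
  derivable (fun _ => True)
    (fun ps s => lambek_meet_rules ps s \/ constant_rules ps s \/ product_rules ps s).

Definition derivable_Lpf01 : (sequent -> Prop) -> sequent -> Prop :=
  derivable product_free
    (fun ps s => lambek_meet_rules ps s \/ constant_rules ps s).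

Definition derivable_Lpf : (sequent -> Prop) -> sequent -> Prop :=
  derivable (fun A => product_free A /\ constant_free A) lambek_meet_rules.

(* Main.v *)
Require Import Defs.
From Stdlib Require Import List.
Import ListNotations.

(** The product-free calculus has a phase model on the free monoid of lists of
    product-free formulae: a formula denotes a set of lists closed under the
    Galois connection induced by derivability of [G, P, D ⊢ C], and a product
    denotes the closure of the pointwise concatenation. The full calculus is
    sound in this model, and every product-free [A] denotes exactly
    [{P | P ⊢ A is derivable without product}]. Hence a product-free sequent
    derivable with products holds in the model, and instantiating each
    antecedent formula [A] by the one-element list [[A]] gives a product-free
    derivation. *)

(** Abstracts over the two target calculi, so that one model construction serves both. The constant
    rules are demanded only when the language has a constant, which lets the calculus without
    constants qualify. *)
Record product_free_calculus (lang : formula -> Prop) (R : rules) : Prop := {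
  lang_Var n : lang (Var n);
  lang_Prod A B : ~ lang (Prod A B);
  lang_Under A B : lang (Under A B) <-> lang A /\ lang B;
  lang_Over A B : lang (Over A B) <-> lang A /\ lang B;
  lang_Meet A B : lang (Meet A B) <-> lang A /\ lang B;
  rules_lambek ps s : lambek_meet_rules ps s -> R ps s;
  rules_constant ps s : lang Zero \/ lang One -> constant_rules ps s -> R ps s
}.

Section PhaseModel.

Context (lang : formula -> Prop) (R : rules) (H : sequent -> Prop)
  (calc : product_free_calculus lang R)
  (H_lang : forall s, H s -> sequent_in lang s).

Local Notation der := (derivable lang R H).
Local Notation words := (Forall lang).

(** * Basic derivations in the product-free calculus *)

Lemma derivable_in_lang s : der s -> sequent_in lang s.
Proof. destruct 1; assumption. Qed.

Lemma derivable_lambek ps s :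
  lambek_meet_rules ps s -> sequent_in lang s -> Forall der ps -> der s.
Proof.
  intros r ls dps. apply derivable_rule with ps; trivial.
  - exact (rules_lambek _ _ calc _ _ r).
  - now apply Forall_forall.
Qed.

Lemma derivable_constant ps s :
  lang Zero \/ lang One ->
  constant_rules ps s -> sequent_in lang s -> Forall der ps -> der s.
Proof.
  intros lc r ls dps. apply derivable_rule with ps; trivial.
  - exact (rules_constant _ _ calc _ _ lc r).
  - now apply Forall_forall.
Qed.

Lemma derivable_id A : lang A -> der ([A] ⊢ A).
Proof.
  intros lA. eapply derivable_lambek; [apply ax_id | | constructor].
  split; simpl; auto.
Qed.

Lemma derivable_cut G P D A C :
  der (P ⊢ A) -> der (G ++ [A] ++ D ⊢ C) -> der (G ++ P ++ D ⊢ C).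
Proof.
  intros d1 d2. eapply derivable_lambek; [apply cut with (A := A) | | auto].
  apply derivable_in_lang in d1 as [lP _]; apply derivable_in_lang in d2 as [lG lC].
  simpl in *. split; simpl; trivial.
  rewrite Forall_app in lG; destruct lG as [lG lD].
  inversion_clear lD. repeat rewrite Forall_app; auto.
Qed.

(** * Closed sets (biorthogonals with respect to contexts [G, _, D ⊢ C]) and the denotation of
    formulae *)

Definition closure (X : list formula -> Prop) (P : list formula) : Prop :=
  words P /\
  forall G D C, words G -> words D -> lang C ->
    (forall Q, X Q -> der (G ++ Q ++ D ⊢ C)) -> der (G ++ P ++ D ⊢ C).

Definition closed (X : list formula -> Prop) : Prop :=
  forall P, closure X P -> X P.

Lemma closure_closed X : closed (closure X).
Proof.
  intros P [lP cP]. split; trivial. intros G D C lG lD lC hX.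
  apply cP; trivial. intros Q [_ cQ]. auto.
Qed.

Lemma closure_incl (X : list formula -> Prop) P : words P -> X P -> closure X P.
Proof. intros lP XP. split; auto. Qed.

(** A context [(G', D', C)] around [G ++ P ++ D] is the context [(G' ++ G, D ++ D', C)] around [P].
    So a closed set that contains the generators placed between [G] and [D] contains their whole
    closure there. *)
Lemma closed_context (X Y : list formula -> Prop) G D P :
  closed Y -> words G -> words D ->
  (forall Q, X Q -> Y (G ++ Q ++ D)) ->
  closure X P -> Y (G ++ P ++ D).
Proof.
  intros cY lG lD XY [lP cP]. apply cY. split.
  - now repeat rewrite Forall_app.
  - intros G' D' C lG' lD' lC hY.
    specialize (cP (G' ++ G) (D ++ D') C).
    repeat rewrite <- app_assoc in cP; repeat rewrite <- app_assoc.
    apply cP; try (now apply Forall_app); trivial.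
    intros Q XQ. specialize (hY _ (XY Q XQ)).
    repeat rewrite <- app_assoc in hY. now repeat rewrite <- app_assoc.
Qed.

(** Defined on all formulae, since a derivation with products may leave [lang]. [Zero] is the least
    closed set, [One] the closure of the monoid unit, and the divisions are residuals; there
    [words P] excludes lists outside the language, which would enter if [A] denoted the empty
    set. *)
Fixpoint interp (A : formula) (P : list formula) : Prop :=
  match A with
  | Var n => der (P ⊢ Var n)
  | Zero => closure (fun _ => False) P
  | One => closure (fun Q => Q = []) P
  | Prod A B =>
      closure (fun Q => exists Q1 Q2, Q = Q1 ++ Q2 /\ interp A Q1 /\ interp B Q2) P
  | Under A B => words P /\ forall Q, interp A Q -> interp B (Q ++ P)
  | Over B A => words P /\ forall Q, interp A Q -> interp B (P ++ Q)
  | Meet A B => interp A P /\ interp B P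
  end.

Lemma interp_words A P : interp A P -> words P.
Proof.
  revert P; induction A; intros P; simpl; try (intros []; now auto).
  intros d. now apply derivable_in_lang in d as [].
Qed.

Lemma interp_closed A : closed (interp A).
Proof.
  induction A as [n | | | A IHA B IHB | A IHA B IHB | B IHB A IHA | A IHA B IHB];
    try apply closure_closed; intros P cP; simpl.
  (* The denotation of a variable is cut out by the single context with empty sides and succedent
     [Var n]. *)
  - destruct cP as [_ cP]. specialize (cP [] [] (Var n)).
    simpl in cP. rewrite app_nil_r in cP. apply cP; auto.
    + exact (lang_Var _ _ calc n).
    + intros Q. now rewrite app_nil_r.
  - split; [apply cP |]. intros Q AQ.
    rewrite <- (app_nil_r P).
    apply closed_context with (interp (Under A B)); eauto using interp_words.
    intros Q' [_ h]. rewrite app_nil_r. auto.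
  - split; [apply cP |]. intros Q AQ.
    apply (closed_context (interp (Over B A)) (interp B) [] Q);
      eauto using interp_words.
    intros Q' [_ h]. simpl. auto.
  - destruct cP as [lP cP].
    split; [apply IHA | apply IHB]; split; trivial;
      intros G D C lG lD lC h; apply cP; trivial; intros Q []; auto.
Qed.

(** Left to right, constants are tested in the empty context with themselves as succedent, and
    divisions are applied to [[A]], which lies in [interp A] by the identity axiom. Right to left, a
    cut against a left rule or the zero axiom inverts the connective. *)
Lemma interp_derivable A :
  lang A -> forall P, interp A P <-> der (P ⊢ A).
Proof.
  induction A as [n | | | A IHA B IHB | A IHA B IHB | B IHB A IHA | A IHA B IHB];
    intros lA P; simpl.
  - reflexivity.
  - split.
    + intros [_ cP]. specialize (cP [] [] Zero). simpl in cP.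
      rewrite app_nil_r in cP. apply cP; tauto || constructor.
    + intros d. split; [now apply derivable_in_lang in d as [] |].
      intros G D C lG lD lC _. apply derivable_cut with Zero; trivial.
      eapply derivable_constant; [auto | apply ax_zero | | constructor].
      split; simpl; trivial. apply Forall_app; auto.
  - split.
    + intros [_ cP]. specialize (cP [] [] One). simpl in cP.
      rewrite app_nil_r in cP. apply cP; auto. intros Q ->.
      eapply derivable_constant; [auto | apply ax_one | | constructor].
      split; simpl; auto.
    + intros d. split; [now apply derivable_in_lang in d as [] |].
      intros G D C lG lD lC h. apply derivable_cut with One; trivial.
      eapply derivable_constant;
        [auto | apply one_L | | constructor; [exact (h [] eq_refl) | constructor]].
      split; simpl; trivial. apply Forall_app; auto.
  - now destruct (lang_Prod _ _ calc A B).
  - pose proof (proj1 (lang_Under _ _ calc A B) lA) as [lA' lB].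
    specialize (IHA lA'); specialize (IHB lB). split.
    + intros [lP h]. eapply derivable_lambek; [apply under_R | now split |].
      constructor; [| constructor].
      apply IHB, h, IHA, derivable_id, lA'.
    + intros d. split; [now apply derivable_in_lang in d as [] |].
      intros Q AQ. apply IHA in AQ. apply IHB.
      rewrite <- (app_nil_r P). apply derivable_cut with (Under A B); trivial.
      apply derivable_lambek with (ps := [Q ⊢ A; [] ++ [B] ++ [] ⊢ B]).
      * apply (under_L [] Q [] A B B).
      * apply derivable_in_lang in AQ as [lQ _].
        split; simpl; trivial. apply Forall_app; simpl; auto.
      * constructor; [exact AQ |]. constructor; [now apply derivable_id | constructor].
  - pose proof (proj1 (lang_Over _ _ calc B A) lA) as [lB lA'].
    specialize (IHA lA'); specialize (IHB lB). split.
    + intros [lP h]. eapply derivable_lambek; [apply over_R | now split |].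
      constructor; [| constructor].
      apply IHB, h, IHA, derivable_id, lA'.
    + intros d. split; [now apply derivable_in_lang in d as [] |].
      intros Q AQ. apply IHA in AQ. apply IHB.
      apply (derivable_cut [] P Q (Over B A)); trivial.
      apply derivable_lambek with (ps := [Q ⊢ A; [] ++ [B] ++ [] ⊢ B]).
      (* Only the occurrence in the conclusion changes: it supplies the empty right context of
         [over_L]. *)
      * rewrite <- (app_nil_r Q) at 2. apply (over_L [] Q [] A B B).
      * apply derivable_in_lang in AQ as [lQ _].
        split; simpl; auto.
      * constructor; [exact AQ |]. constructor; [now apply derivable_id | constructor].
  - pose proof (proj1 (lang_Meet _ _ calc A B) lA) as [lA' lB].
    rewrite (IHA lA'), (IHB lB). split.
    + intros [dA dB]. eapply derivable_lambek; [apply meet_R | | auto].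
      split; trivial. now apply derivable_in_lang in dA as [].
    + intros d.
      assert (dAB : forall C, lang C ->
        lambek_meet_rules [[] ++ [C] ++ [] ⊢ C] ([] ++ [Meet A B] ++ [] ⊢ C) ->
        der (P ⊢ C)).
      { intros C lC r. rewrite <- (app_nil_r P).
        apply (derivable_cut [] P [] (Meet A B)); trivial.
        eapply derivable_lambek; [exact r | split; simpl; auto |].
        constructor; [now apply derivable_id | constructor]. }
      split; apply dAB; trivial; constructor.
Qed.

(** Plain concatenation, without closure: the succedent denotes a closed set, so closing the
    antecedent would not change validity. *)
Fixpoint interp_list (L : list formula) (P : list formula) : Prop :=
  match L with
  | [] => P = []
  | A :: L => exists Q Q', P = Q ++ Q' /\ interp A Q /\ interp_list L Q'
  end.

Lemma interp_list_app L1 L2 P :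
  interp_list (L1 ++ L2) P <->
  exists P1 P2, P = P1 ++ P2 /\ interp_list L1 P1 /\ interp_list L2 P2.
Proof.
  revert P; induction L1 as [| A L1 IH]; intros P; simpl.
  - split.
    + intros h. now exists [], P.
    + now intros (P1 & P2 & -> & -> & h).
  - split.
    + intros (Q & Q' & -> & AQ & h). apply IH in h as (P1 & P2 & -> & h1 & h2).
      exists (Q ++ P1), P2. rewrite <- app_assoc. eauto 8.
    + intros (P1 & P2 & -> & (Q & Q' & -> & AQ & h1) & h2).
      exists Q, (Q' ++ P2). rewrite <- app_assoc, IH. eauto 8.
Qed.

Lemma interp_list1 A P : interp_list [A] P <-> interp A P.
Proof.
  simpl. split.
  - intros (Q & Q' & -> & h & ->). now rewrite app_nil_r.
  - intros h. exists P, []. now rewrite app_nil_r.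
Qed.

Lemma interp_list_middle G L D P :
  interp_list (G ++ L ++ D) P <->
  exists g p d, P = g ++ p ++ d /\
    interp_list G g /\ interp_list L p /\ interp_list D d.
Proof.
  rewrite interp_list_app. split.
  - intros (g & q & -> & hg & h). apply interp_list_app in h as (p & d & -> & hp & hd).
    now exists g, p, d.
  - intros (g & p & d & -> & hg & hp & hd). exists g, (p ++ d).
    rewrite interp_list_app. eauto 8.
Qed.

Lemma interp_list_words L P : interp_list L P -> words P.
Proof.
  revert P; induction L as [| A L IH]; simpl; intros P.
  - intros ->; constructor.
  - intros (Q & Q' & -> & h & h'). apply Forall_app. eauto using interp_words.
Qed.

(** * Validity of sequents and soundness of the full calculus *)

Definition valid (s : sequent) : Prop :=
  forall P, interp_list (antecedent s) P -> interp (succedent s) P.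

Lemma valid_replace G L L' D C :
  (forall P, interp_list L' P -> interp_list L P) ->
  valid (G ++ L ++ D ⊢ C) -> valid (G ++ L' ++ D ⊢ C).
Proof.
  intros hL v P h. apply v. simpl in *. rewrite interp_list_middle in h |- *.
  destruct h as (g & p & d & -> & hg & hp & hd). eauto 10.
Qed.

(** Serves the left rules of [One] and [Prod], whose denotations are closures: as [interp C] is
    closed, only the generators [X] need checking. *)
Lemma valid_closure G L A (X : list formula -> Prop) D C :
  (forall P, interp A P -> closure X P) ->
  (forall P, X P -> interp_list L P) ->
  valid (G ++ L ++ D ⊢ C) -> valid (G ++ [A] ++ D ⊢ C).
Proof.
  intros hA hL v P h. cbn [antecedent succedent] in *.
  apply interp_list_middle in h as (g & p & d & -> & hg & hp & hd).
  apply interp_list1, hA in hp.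
  apply closed_context with X; eauto using interp_closed, interp_list_words, interp_words.
  intros Q XQ. apply v. simpl. apply interp_list_middle. eauto 10.
Qed.

Lemma lambek_meet_rules_sound ps s :
  lambek_meet_rules ps s -> Forall valid ps -> valid s.
Proof.
  intros r vps. destruct r;
    repeat match goal with v : Forall valid (_ :: _) |- _ => inversion_clear v end.
  - intros Q h. now apply interp_list1.
  - apply valid_replace with [A]; trivial.
    intros Q h. apply interp_list1. auto.
  (* [P ++ [Under A B]] becomes one block, whose lists all lie in [interp B] by residuation. *)
  - rewrite (app_assoc P). apply valid_replace with [B]; trivial.
    intros Q h. apply interp_list_app in h as (q & r & -> & hq & hr).
    apply interp_list1 in hr as [_ hr]. apply interp_list1. auto.
  - intros Q h. split; [eapply interp_list_words; eassumption |].
    intros Q' h'. match goal with v : valid _ |- _ => apply v end.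
    exists Q', Q. auto.
  - rewrite (app_assoc [Over B A]). apply valid_replace with [B]; trivial.
    intros Q h. apply interp_list_app in h as (q & r & -> & hq & hr).
    apply interp_list1 in hq as [_ hq]. apply interp_list1. auto.
  - intros Q h. split; [eapply interp_list_words; eassumption |].
    intros Q' h'. match goal with v : valid _ |- _ => apply v end.
    apply interp_list_app. exists Q, Q'. rewrite interp_list1. auto.
  - apply valid_replace with [A]; trivial.
    intros Q h. apply interp_list1 in h as []. now apply interp_list1.
  - apply valid_replace with [A]; trivial.
    intros Q h. apply interp_list1 in h as []. now apply interp_list1.
  - intros Q h. split; auto.
Qed.

Lemma constant_rules_sound ps s :
  constant_rules ps s -> Forall valid ps -> valid s.
Proof.
  intros r vps. destruct r.
  - intros Q h. cbn [antecedent succedent] in *.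
    apply interp_list_middle in h as (g & p & d & -> & hg & hp & hd).
    apply interp_list1 in hp.
    (* [Zero] has no generators, so nothing is left to check inside the context. *)
    apply closed_context with (fun _ => False);
      eauto using interp_closed, interp_list_words, interp_words. tauto.
  - intros Q ->. apply closure_incl; auto.
  - inversion_clear vps.
    apply valid_closure with (L := []) (X := fun Q => Q = []); auto.
Qed.

Lemma product_rules_sound ps s :
  product_rules ps s -> Forall valid ps -> valid s.
Proof.
  intros r vps. destruct r.
  - inversion_clear vps. eapply valid_closure with (L := [A; B]); [| | eassumption].
    + intros Q h. exact h.
    + intros Q (Q1 & Q2 & -> & h1 & h2).
      exists Q1, Q2. rewrite interp_list1. auto.
  - inversion_clear vps as [| ? ? vA v]. inversion_clear v as [| ? ? vB _].
    intros Q h. apply closure_incl; [eapply interp_list_words; eassumption |].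
    apply interp_list_app in h as (q & r & -> & hq & hr).
    exists q, r. repeat split; [apply vA | apply vB]; trivial.
Qed.

(** * Return from validity to derivability *)

Lemma interp_list_derivable L P G C :
  words L -> interp_list L P -> der (G ++ L ⊢ C) -> der (G ++ P ⊢ C).
Proof.
  intros lL. revert G P. induction lL as [| A L lA lL IH]; intros G P; simpl.
  - now intros ->.
  - intros (Q & Q' & -> & AQ & hL) d.
    apply interp_derivable in AQ; trivial.
    (* The list [Q] that replaces [A] by cut is absorbed into the left context before the tail is
       treated. *)
    rewrite app_assoc. apply IH; trivial. rewrite <- app_assoc.
    now apply derivable_cut with A.
Qed.

Lemma interp_list_refl L : words L -> interp_list L L.
Proof.
  induction 1 as [| A L lA lL IH]; simpl; trivial.
  exists [A], L. repeat split; trivial.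
  now apply interp_derivable, derivable_id.
Qed.

Lemma derivable_L01_valid s : derivable_L01 H s -> valid s.
Proof.
  induction 1 as [[L C] _ Hs | ps s _ r _ IH].
  (* A hypothesis lies in [lang], where denotation is derivability, so cutting into its antecedent
     proves it valid. *)
  - pose proof (H_lang _ Hs) as [lL lC]. intros P h.
    apply interp_derivable; trivial.
    apply (interp_list_derivable L P []); trivial.
    now apply derivable_hyp.
  - apply Forall_forall in IH. destruct r as [r | [r | r]].
    + now apply lambek_meet_rules_sound with ps.
    + now apply constant_rules_sound with ps.
    + now apply product_rules_sound with ps.
Qed.

Lemma derivable_L01_conservative s :
  sequent_in lang s -> derivable_L01 H s -> der s.
Proof.
  destruct s as [L C]. intros [lL lC] d.
  apply interp_derivable; trivial.
  now apply (derivable_L01_valid _ d), interp_list_refl.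
Qed.

End PhaseModel.

Theorem theorem6p1 (H : sequent -> Prop) (P : list formula) (B : formula)
  (H_pf : forall s, H s -> sequent_in product_free s)
  (s_pf : sequent_in product_free (P ⊢ B))
  (der : derivable_L01 H (P ⊢ B)) :
  derivable_Lpf01 H (P ⊢ B) /\
  ((forall s, H s -> sequent_in constant_free s) ->
   sequent_in constant_free (P ⊢ B) ->
   derivable_Lpf H (P ⊢ B)).
Proof.
  split.
  - apply derivable_L01_conservative; trivial.
    split; simpl; tauto.
  - intros H_cf s_cf.
    assert (both : forall s, sequent_in product_free s -> sequent_in constant_free s ->
      sequent_in (fun A => product_free A /\ constant_free A) s).
    { intros s [lL lC] [lL' lC']. split; auto using Forall_and. }
    apply derivable_L01_conservative; auto.
    (* The clause on constant rules holds vacuously, as [constant_free] excludes both constants. *)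
    split; simpl; tauto.
Qed.
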